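(* Let $p$ and $q$ be relatively prime positive integers, and let $E$ be the electric field of the uniformly charged $(p,q)$-torus knot $r:[0,2\pi]\to\mathbb{R}^3$, $r(t) = \big((\cos(qt)+2)\cos(pt),\ (\cos(qt)+2)\sin(pt),\ -\sin(qt)\big)$. Then along the $z$-axis the electric field $E$ is zero only at the origin; that is, for every $\alpha\in\mathbb{R}$, if $E(0,0,\alpha) = 0$ then $\alpha = 0$.
   Context: For relatively prime positive integers $p,q$, the $(p,q)$-torus knot is the curve $r:[0,2\pi]\to\mathbb{R}^3$ given by $r(t) = \big((\cos(qt)+2)\cos(pt),\ (\cos(qt)+2)\sin(pt),\ -\sin(qt)\big)$. The electric potential of the uniformly charged knot at a point $x\in\mathbb{R}^3$ not on the knot is $\Phi(x) = \int_0^{2\pi} \frac{|r'(t)|}{|x-r(t)|}\,dt$, where $|\cdot|$ is the Euclidean norm. The electric field is defined as the gradient of the potential, $E(x) = \nabla\Phi(x)\in\mathbb{R}^3$. *)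

(* Defs.v *)
From Stdlib Require Import Reals.
From Coquelicot Require Import Coquelicot.
Open Scope R_scope.

Definition R3 : Type := (R * R * R)%type.

Definition px (v : R3) : R := fst (fst v).
Definition py (v : R3) : R := snd (fst v).
Definition pz (v : R3) : R := snd v.

Definition sub3 (u v : R3) : R3 := (px u - px v, py u - py v, pz u - pz v).

Definition norm3 (v : R3) : R := sqrt (px v ^ 2 + py v ^ 2 + pz v ^ 2).

Definition velocity (r : R -> R3) (t : R) : R3 :=
  (Derive (fun s => px (r s)) t,
   Derive (fun s => py (r s)) t,
   Derive (fun s => pz (r s)) t).

Definition gradient (f : R3 -> R) (v : R3) : R3 :=
  (Derive (fun x => f (x, py v, pz v)) (px v),
   Derive (fun y => f (px v, y, pz v)) (py v),
   Derive (fun z => f (px v, py v, z)) (pz v)).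

Definition torus_knot (p q : nat) (t : R) : R3 :=
  ((cos (INR q * t) + 2) * cos (INR p * t),
   (cos (INR q * t) + 2) * sin (INR p * t),
   - sin (INR q * t)).

(* Meaningful only for points off the curve; on it, [RInt] and division
   by zero yield unspecified values. *)
Definition potential (r : R -> R3) (x : R3) : R :=
  RInt (fun t => norm3 (velocity r t) / norm3 (sub3 x (r t))) 0 (2 * PI).

(* Sign convention: the gradient itself, not its negative. *)
Definition electric_field (r : R -> R3) (x : R3) : R3 :=
  gradient (potential r) x.

(* Main.v *)
Require Import Defs.
From Stdlib Require Import Reals Lra.
From Coquelicot Require Import Coquelicot.
Open Scope R_scope.

(** Seen from a point of the z-axis, a charged curve acts like a
    superposition of rings centred on the axis: only the distance [rho] to the
    axis and the height [h] of each curve element matter.  The half-turn about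
    the x-axis maps the torus knot to itself, taking the point of parameter [t]
    to that of parameter [2 PI - t]: the distance [rho = 2 + cos (q t)] and the
    speed are kept, and the height [- sin (q t)] changes sign.  So the rings
    come in pairs at heights [h] and [-h], with equal radii and charges.

    The axial pull of one ring, [d / (rho^2 + d^2)^(3/2)] at distance [d], is
    not monotone in [d], so between two rings the nearer one could win.
    It does not as long as [2 h^2 < rho^2], that is, as long as the pull is
    still increasing at distance [h] ([pair_pull_pos]).  On the torus this
    condition reads [2 + 4 c + 3 c^2 > 0] with [c = cos (q t)], and that
    quadratic has negative discriminant.  So at every point of the axis with
    [z > 0] each pair contributes with the same sign, and the integral over
    all pairs cannot vanish; [z < 0] follows because the total pull of a pair
    is odd in [z].

    The analytic part is differentiation under the integral sign
    ([is_derive_axial_potential]) and the substitution [t -> 2 PI - t]. *)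

(** * The pull of a symmetric pair of rings *)

(** Minus the derivative of [1 / sqrt (P + d^2)]: the axial attraction, at
    signed distance [d] from its plane, of a unit ring of squared radius [P]. *)
Definition pull (P d : R) : R := d / sqrt (P + d ^ 2) ^ 3.

Lemma add_sqr_gt0 (P d : R) : 0 < P -> 0 < P + d ^ 2.
Proof. intros HP; assert (H := pow2_ge_0 d); lra. Qed.

Lemma pull_opp (P d : R) : pull P (- d) = - pull P d.
Proof.
unfold pull, Rdiv; replace ((- d) ^ 2) with (d ^ 2) by ring; ring.
Qed.

Lemma pull_ge0 (P d : R) : 0 < P -> 0 <= d -> 0 <= pull P d.
Proof.
intros HP Hd; apply Rmult_le_pos; [exact Hd|].
left; apply Rinv_0_lt_compat, pow_lt, sqrt_lt_R0, add_sqr_gt0, HP.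
Qed.

Lemma pull_gt0 (P d : R) : 0 < P -> 0 < d -> 0 < pull P d.
Proof.
intros HP Hd; apply Rdiv_lt_0_compat; [exact Hd|].
apply pow_lt, sqrt_lt_R0, add_sqr_gt0, HP.
Qed.

(** With [m = s^2 - z^2], the difference of the two squared cross products
    is a positive multiple of [P^3 - 3 P m^2 - m^2 (4 s^2 - 2 m)].  For
    [0 <= m <= s^2] this is smallest at [m = s^2], where it factors as
    [(P + s^2)^2 (P - 2 s^2)]. *)
Lemma pull_lt_across (P s z : R) :
  0 < z -> z < s -> 2 * s ^ 2 < P -> pull P (s - z) < pull P (s + z).
Proof.
intros Hz Hzs HP.
assert (HP0 : 0 < P) by nra.
unfold pull.
set (a := s - z); set (b := s + z).
assert (Ha : 0 < a) by (unfold a; lra).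
assert (Hb : 0 < b) by (unfold b; lra).
assert (HA : 0 < P + a ^ 2) by now apply add_sqr_gt0.
assert (HB : 0 < P + b ^ 2) by now apply add_sqr_gt0.
assert (Hsa := sqrt_lt_R0 _ HA); assert (Hsb := sqrt_lt_R0 _ HB).
assert (Hpa := pow_lt _ 3 Hsa); assert (Hpb := pow_lt _ 3 Hsb).
assert (cube : forall x, 0 < x -> (sqrt x ^ 3) ^ 2 = x ^ 3).
{ intros x Hx; replace ((sqrt x ^ 3) ^ 2) with ((sqrt x ^ 2) ^ 3) by ring.
  now rewrite pow2_sqrt by lra. }
assert (sq : (a * sqrt (P + b ^ 2) ^ 3) ^ 2 < (b * sqrt (P + a ^ 2) ^ 3) ^ 2).
{ rewrite !Rpow_mult_distr, !cube by assumption.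
  set (m := s ^ 2 - z ^ 2).
  assert (Hm0 : 0 < m) by (unfold m; nra).
  assert (Hms : m <= s ^ 2) by (unfold m; nra).
  assert (key : 0 < P ^ 3 - 3 * P * m ^ 2 - m ^ 2 * (4 * s ^ 2 - 2 * m)).
  { assert (E : 0 < (P + s ^ 2) ^ 2 * (P - 2 * s ^ 2)).
    { apply Rmult_lt_0_compat; [apply pow_lt; nra | lra]. }
    assert (D1 : 0 <= 3 * P * ((s ^ 2) ^ 2 - m ^ 2)).
    { apply Rmult_le_pos; [lra|].
      replace ((s ^ 2) ^ 2 - m ^ 2) with ((s ^ 2 - m) * (s ^ 2 + m)) by ring.
      apply Rmult_le_pos; lra. }
    assert (D2 : 0 <= 2 * (s ^ 2 - m) * ((s ^ 2 - m) * (s ^ 2 + m) + s ^ 2 * m)).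
    { apply Rmult_le_pos; [lra|].
      assert (0 <= (s ^ 2 - m) * (s ^ 2 + m)) by (apply Rmult_le_pos; lra).
      nra. }
    nra. }
  assert (F : b ^ 2 * (P + a ^ 2) ^ 3 - a ^ 2 * (P + b ^ 2) ^ 3
    = 4 * s * z * (P ^ 3 - 3 * P * m ^ 2 - m ^ 2 * (4 * s ^ 2 - 2 * m))).
  { unfold a, b, m; ring. }
  assert (0 < 4 * s * z * (P ^ 3 - 3 * P * m ^ 2 - m ^ 2 * (4 * s ^ 2 - 2 * m))).
  { apply Rmult_lt_0_compat; [nra | exact key]. }
  lra. }
assert (cross : a * sqrt (P + b ^ 2) ^ 3 < b * sqrt (P + a ^ 2) ^ 3).
{ apply Rsqr_incrst_0; [|nra|nra]; unfold Rsqr; nra. }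
apply (Rmult_lt_reg_r (sqrt (P + a ^ 2) ^ 3 * sqrt (P + b ^ 2) ^ 3)); [nra|].
replace (a / _ * _) with (a * sqrt (P + b ^ 2) ^ 3) by (field; lra).
replace (b / _ * _) with (b * sqrt (P + a ^ 2) ^ 3) by (field; lra).
exact cross.
Qed.

(** Outside the pair both rings pull the same way.  Between them they oppose
    each other, and under [2 s^2 < P] the pull is dominated by the farther
    ring. *)
Lemma pair_pull_pos (P s z : R) :
  0 < z -> 2 * s ^ 2 < P -> 0 < pull P (z + s) + pull P (z - s).
Proof.
intros Hz HP.
assert (HP0 : 0 < P) by nra.
(* The statement is symmetric in the sign of s. *)
assert (nonneg : forall s, 0 <= s -> 2 * s ^ 2 < P ->
          0 < pull P (z + s) + pull P (z - s)).
{ clear s HP; intros s Hs HP.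
  destruct (Rlt_le_dec z s) as [Hzs | Hsz].
  - replace (z - s) with (- (s - z)) by ring; rewrite pull_opp, (Rplus_comm z s).
    assert (H := pull_lt_across P s z Hz Hzs HP); lra.
  - assert (H1 : 0 < pull P (z + s)) by (apply pull_gt0; lra).
    assert (H2 : 0 <= pull P (z - s)) by (apply pull_ge0; lra).
    lra. }
destruct (Rle_lt_dec 0 s) as [Hs | Hs]; [now apply nonneg|].
assert (H : 0 < pull P (z + - s) + pull P (z - - s)).
{ apply nonneg; nra. }
unfold Rminus in H; rewrite Ropp_involutive in H; unfold Rminus; lra.
Qed.

(** * The field on the axis of a charged curve *)

Lemma is_derive_ring_potential (w P h z : R) : 0 < P ->
  is_derive (fun x => w / sqrt (P + (x - h) ^ 2)) z (- (w * pull P (z - h))).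
Proof.
intros HP; unfold pull.
assert (H := add_sqr_gt0 P (z - h) HP).
assert (Hs := sqrt_lt_R0 _ H).
auto_derive; replace (z + - h) with (z - h) by ring;
  replace (P + (z - h) * ((z - h) * 1)) with (P + (z - h) ^ 2) by ring.
- repeat split; [exact H | lra].
- field; lra.
Qed.

Lemma continuous_pull {U : UniformSpace} (P d : U -> R) (x : U) :
  0 < P x -> continuous P x -> continuous d x ->
  continuous (fun u => pull (P u) (d u)) x.
Proof.
intros HP cP cd; unfold pull, Rdiv.
assert (H := add_sqr_gt0 (P x) (d x) HP).
assert (cs : continuous (fun u => sqrt (P u + d u ^ 2)) x).
{ apply (continuous_comp _ sqrt); [|apply continuous_sqrt].
  apply (continuous_plus P (fun u => d u ^ 2)); [exact cP|].
  simpl; apply (continuous_mult d (fun u => d u * 1)); [exact cd|].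
  apply (continuous_mult d (fun _ => 1)); [exact cd | apply continuous_const]. }
apply (continuous_mult d (fun u => / sqrt (P u + d u ^ 2) ^ 3)); [exact cd|].
apply (continuous_comp _ Rinv).
- apply (continuous_comp _ (fun y => y ^ 3)); [exact cs|].
  apply (ex_derive_continuous (fun y : R => y ^ 3)); auto_derive; exact I.
- apply continuous_Rinv, Rgt_not_eq, pow_lt, sqrt_lt_R0, H.
Qed.

(** Differentiation under the integral sign; [P] and [h] are the squared
    distance to the axis and the height of the curve, [w] its charge density. *)
Lemma is_derive_axial_potential (w P h : R -> R) (a b z : R) :
  (forall t, 0 < P t) ->
  (forall t, continuous w t) -> (forall t, continuous P t) ->
  (forall t, continuous h t) ->
  is_derive (fun x => RInt (fun t => w t / sqrt (P t + (x - h t) ^ 2)) a b) z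
            (- RInt (fun t => w t * pull (P t) (z - h t)) a b).
Proof.
intros HP cw cP ch.
assert (D : forall x t,
  is_derive (fun u => w t / sqrt (P t + (u - h t) ^ 2)) x
            (- (w t * pull (P t) (x - h t)))).
{ intros x t; apply is_derive_ring_potential, HP. }
assert (cpull : forall x t, continuous (fun u => w u * pull (P u) (x - h u)) t).
{ intros x t; apply (continuous_mult w); [apply cw|].
  apply continuous_pull; [apply HP | apply cP |].
  apply (continuous_minus (fun _ => x) h); [apply continuous_const | apply ch]. }
replace (- RInt _ a b)
  with (RInt (fun t => Derive (fun u => w t / sqrt (P t + (u - h t) ^ 2)) z) a b).
2:{ rewrite <- (RInt_opp (V := R_CompleteNormedModule)).
    - apply RInt_ext; intros t _; apply is_derive_unique, D.
    - apply (ex_RInt_continuous (V := R_CompleteNormedModule)); intros; apply cpull. }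
apply (is_derive_RInt_param (fun x t => w t / sqrt (P t + (x - h t) ^ 2))).
- apply filter_forall; intros x t _; eexists; apply D.
- intros t _.
  apply (continuity_2d_pt_ext (fun x t => - (w t * pull (P t) (x - h t)))).
  { intros x u; symmetry; apply is_derive_unique, D. }
  apply continuity_2d_pt_filterlim.
  assert (along : forall f : R -> R, continuous f t ->
            continuous (fun v : R * R => f (snd v)) (z, t)).
  { intros f cf; apply (continuous_comp snd f); [apply continuous_snd | exact cf]. }
  apply (continuous_opp (fun v : R * R => w (snd v) * pull (P (snd v)) (fst v - h (snd v)))
           (z, t)).
  apply (continuous_mult (fun v : R * R => w (snd v))); [apply along, cw|].
  apply continuous_pull; [apply HP | apply along, cP |].
  apply (continuous_minus fst (fun v : R * R => h (snd v)));
    [apply continuous_fst | apply along, ch].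
- apply filter_forall; intros x.
  apply (ex_RInt_continuous (V := R_CompleteNormedModule)); intros t _.
  apply (continuous_mult w); [apply cw|].
  apply continuous_Rinv_comp.
  + apply continuous_sqrt_comp, (continuous_plus P); [apply cP|].
    apply (continuous_comp (fun t => x - h t) (fun y => y ^ 2)).
    * apply (continuous_minus (fun _ => x) h); [apply continuous_const | apply ch].
    * apply (ex_derive_continuous (fun y : R => y ^ 2)); auto_derive; exact I.
  + apply Rgt_not_eq, sqrt_lt_R0, add_sqr_gt0, HP.
Qed.

(** Averaging the integral with its image under [t -> T - t] turns it into an
    integral over pairs of rings, to which [pair_pull_pos] applies. *)
Lemma axial_pull_pos (w P h : R -> R) (T z : R) :
  0 < T -> 0 < z ->
  (forall t, continuous w t) -> (forall t, continuous P t) ->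
  (forall t, continuous h t) ->
  (forall t, 0 < w t) -> (forall t, 2 * h t ^ 2 < P t) ->
  (forall t, w (T - t) = w t) -> (forall t, P (T - t) = P t) ->
  (forall t, h (T - t) = - h t) ->
  0 < RInt (fun t => w t * pull (P t) (z - h t)) 0 T /\
  RInt (fun t => w t * pull (P t) (- z - h t)) 0 T
    = - RInt (fun t => w t * pull (P t) (z - h t)) 0 T.
Proof.
intros HT Hz cw cP ch Hw HhP Sw SP Sh.
assert (HP : forall t, 0 < P t) by (intros t; specialize (HhP t); nra).
assert (cpull : forall d : R -> R, (forall t, continuous d t) ->
          forall t, continuous (fun t => w t * pull (P t) (d t)) t).
{ intros d cd t; apply (continuous_mult w); [apply cw|].
  apply continuous_pull; [apply HP | apply cP | apply cd]. }
assert (cm : forall t, continuous (fun t => z - h t) t).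
{ intros t; apply (continuous_minus (fun _ => z) h); [apply continuous_const | apply ch]. }
assert (cp : forall t, continuous (fun t => z + h t) t).
{ intros t; apply (continuous_plus (fun _ => z) h); [apply continuous_const | apply ch]. }
set (f := fun t => w t * pull (P t) (z - h t)).
set (g := fun t => w t * pull (P t) (z + h t)).
assert (If : ex_RInt f 0 T).
{ apply (ex_RInt_continuous (V := R_CompleteNormedModule)); intros t _; apply (cpull _ cm). }
assert (Ig : ex_RInt g 0 T).
{ apply (ex_RInt_continuous (V := R_CompleteNormedModule)); intros t _; apply (cpull _ cp). }
assert (reflect : RInt g 0 T = RInt f 0 T).
{ assert (E := RInt_comp_lin (V := R_CompleteNormedModule) f (-1) T 0 T).
  replace (-1 * 0 + T) with T in E by ring.
  replace (-1 * T + T) with 0 in E by ring.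
  specialize (E (ex_RInt_swap _ _ _ If)).
  rewrite <- (opp_RInt_swap (V := R_CompleteNormedModule) f) in E by exact If.
  rewrite <- (RInt_ext (V := R_CompleteNormedModule) (fun t => opp (g t))) in E.
  - rewrite (RInt_opp (V := R_CompleteNormedModule)) in E by exact Ig.
    unfold opp in E; simpl in E; lra.
  - intros t _; unfold f, g, opp, scal; simpl; unfold mult; simpl.
    replace (-1 * t + T) with (T - t) by ring.
    rewrite Sw, SP, Sh; replace (z - - h t) with (z + h t) by ring; ring. }
split.
- assert (S : 0 < RInt (fun t => plus (f t) (g t)) 0 T).
  { apply RInt_gt_0; [exact HT | |].
    - intros t _; unfold f, g, plus; simpl.
      assert (H := pair_pull_pos (P t) (h t) z Hz (HhP t)).
      specialize (Hw t); nra.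
    - intros t _; apply (continuous_plus f g); [apply (cpull _ cm) | apply (cpull _ cp)]. }
  rewrite (RInt_plus (V := R_CompleteNormedModule)) in S by assumption.
  unfold plus in S; simpl in S; lra.
- rewrite <- reflect, <- (RInt_opp (V := R_CompleteNormedModule)) by exact Ig.
  apply RInt_ext; intros t _; unfold g, opp; simpl.
  replace (- z - h t) with (- (z + h t)) by ring; rewrite pull_opp; ring.
Qed.

(** * The torus knot *)

Lemma torus_knot_speed (p q : nat) (t : R) :
  norm3 (velocity (torus_knot p q) t)
  = sqrt (INR q ^ 2 + INR p ^ 2 * (cos (INR q * t) + 2) ^ 2).
Proof.
unfold velocity, torus_knot, norm3, px, py, pz; cbn [fst snd].
assert (Dx : is_derive (fun s : R => (cos (INR q * s) + 2) * cos (INR p * s)) t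
  (- INR q * sin (INR q * t) * cos (INR p * t)
   - INR p * (cos (INR q * t) + 2) * sin (INR p * t))).
{ auto_derive; [exact I | ring]. }
assert (Dy : is_derive (fun s : R => (cos (INR q * s) + 2) * sin (INR p * s)) t
  (- INR q * sin (INR q * t) * sin (INR p * t)
   + INR p * (cos (INR q * t) + 2) * cos (INR p * t))).
{ auto_derive; [exact I | ring]. }
assert (Dz : is_derive (fun s : R => - sin (INR q * s)) t (- INR q * cos (INR q * t))).
{ auto_derive; [exact I | ring]. }
rewrite (is_derive_unique _ _ _ Dx), (is_derive_unique _ _ _ Dy),
  (is_derive_unique _ _ _ Dz).
f_equal.
assert (Ep := sin2_cos2 (INR p * t)); assert (Eq := sin2_cos2 (INR q * t)).
unfold Rsqr in Ep, Eq.
set (cp := cos (INR p * t)) in *; set (sp := sin (INR p * t)) in *.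
set (cq := cos (INR q * t)) in *; set (sq := sin (INR q * t)) in *.
transitivity (INR q ^ 2 * (sq * sq * (sp * sp + cp * cp) + cq * cq)
              + INR p ^ 2 * (cq + 2) ^ 2 * (sp * sp + cp * cp)); [ring|].
rewrite Ep, Rmult_1_r, Eq; ring.
Qed.

Lemma torus_knot_axial_distance (p q : nat) (z t : R) :
  norm3 (sub3 (0, 0, z) (torus_knot p q t))
  = sqrt ((cos (INR q * t) + 2) ^ 2 + (z - - sin (INR q * t)) ^ 2).
Proof.
unfold sub3, torus_knot, norm3, px, py, pz; cbn [fst snd].
f_equal.
assert (Ep := sin2_cos2 (INR p * t)); unfold Rsqr in Ep.
transitivity ((cos (INR q * t) + 2) ^ 2
    * (sin (INR p * t) * sin (INR p * t) + cos (INR p * t) * cos (INR p * t))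
    + (z - - sin (INR q * t)) ^ 2); [ring|].
rewrite Ep; ring.
Qed.

Lemma cos_reflect (n : nat) (t : R) : cos (INR n * (2 * PI - t)) = cos (INR n * t).
Proof.
rewrite <- (cos_neg (INR n * t)), <- (cos_period (- (INR n * t)) n).
f_equal; ring.
Qed.

Lemma sin_reflect (n : nat) (t : R) : sin (INR n * (2 * PI - t)) = - sin (INR n * t).
Proof.
rewrite <- (sin_neg (INR n * t)), <- (sin_period (- (INR n * t)) n).
f_equal; ring.
Qed.

Theorem theorem4p2 (p q : nat) (hp : (0 < p)%nat) (hq : (0 < q)%nat)
    (hpq : Nat.gcd p q = 1%nat) :
  forall alpha : R,
    electric_field (torus_knot p q) (0, 0, alpha) = (0, 0, 0) -> alpha = 0.
Proof.
intros alpha HE.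
set (w := fun t => sqrt (INR q ^ 2 + INR p ^ 2 * (cos (INR q * t) + 2) ^ 2)).
set (P := fun t => (cos (INR q * t) + 2) ^ 2).
set (h := fun t => - sin (INR q * t)).
assert (Hq : 0 < INR q) by (apply lt_0_INR, hq).
assert (radicand : forall t, 0 < INR q ^ 2 + INR p ^ 2 * (cos (INR q * t) + 2) ^ 2).
{ intros t.
  assert (0 <= INR p ^ 2 * (cos (INR q * t) + 2) ^ 2)
    by (apply Rmult_le_pos; apply pow2_ge_0).
  assert (0 < INR q ^ 2) by (apply pow_lt, Hq).
  lra. }
assert (cP : forall t, continuous P t).
{ intros t; apply (ex_derive_continuous P); unfold P; auto_derive; exact I. }
assert (ch : forall t, continuous h t).
{ intros t; apply (ex_derive_continuous h); unfold h; auto_derive; exact I. }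
assert (cw : forall t, continuous w t).
{ intros t; apply continuous_sqrt_comp.
  apply (ex_derive_continuous
           (fun t : R => INR q ^ 2 + INR p ^ 2 * (cos (INR q * t) + 2) ^ 2)).
  auto_derive; exact I. }
assert (Hw : forall t, 0 < w t) by (intros t; apply sqrt_lt_R0, radicand).
(* The difference of the two sides is 3 (c + 2/3)^2 + 2/3. *)
assert (HhP : forall t, 2 * h t ^ 2 < P t).
{ intros t; unfold h, P.
  assert (E := sin2_cos2 (INR q * t)); unfold Rsqr in E.
  assert (0 <= (3 * cos (INR q * t) + 2) ^ 2) by apply pow2_ge_0.
  nra. }
assert (HP : forall t, 0 < P t) by (intros t; specialize (HhP t); nra).
assert (HD : RInt (fun t => w t * pull (P t) (alpha - h t)) 0 (2 * PI) = 0).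
{ apply (f_equal snd) in HE.
  unfold electric_field, gradient, px, py, pz in HE; cbn [fst snd] in HE.
  assert (D := is_derive_unique _ _ _
    (is_derive_axial_potential w P h 0 (2 * PI) alpha HP cw cP ch)).
  enough (E : Derive (fun z : R => potential (torus_knot p q) (0, 0, z)) alpha
              = - RInt (fun t => w t * pull (P t) (alpha - h t)) 0 (2 * PI)).
  - rewrite E in HE; lra.
  - rewrite <- D; apply Derive_ext.
    intros z; apply RInt_ext; intros t _.
    now rewrite torus_knot_speed, torus_knot_axial_distance. }
assert (pos : forall z, 0 < z ->
  0 < RInt (fun t => w t * pull (P t) (z - h t)) 0 (2 * PI) /\
  RInt (fun t => w t * pull (P t) (- z - h t)) 0 (2 * PI)
    = - RInt (fun t => w t * pull (P t) (z - h t)) 0 (2 * PI)).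
{ intros z Hz; apply axial_pull_pos; auto.
  - assert (H := PI_RGT_0); lra.
  - intros t; unfold w; now rewrite cos_reflect.
  - intros t; unfold P; now rewrite cos_reflect.
  - intros t; unfold h; now rewrite sin_reflect. }
destruct (Rtotal_order alpha 0) as [Hneg | [H0 | Hpos]]; [| exact H0 |].
- destruct (pos (- alpha)) as [H1 H2]; [lra|].
  rewrite Ropp_involutive in H2; lra.
- destruct (pos alpha Hpos) as [H1 _]; lra.
Qed.
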